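(* For every $n\ge 1$ and every word $x\in\{1,2,3,4\}^n$ we have $B(x)=Q(x)$, where $B(x)$ is the number of proper buildings of $x$ and $Q(x)$ is the signed sum over dispersed Dyck words defined in the context.
   Context: Words and buildings. A word is a finite sequence $x=(x_1,\ldots,x_n)$ of integers; it is a proper coloring if $x_i\neq x_{i+1}$ for all $1\le i<n$. For a permutation $\sigma\in S_n$ of $\{1,\ldots,n\}$ and $1\le t\le n$, let $x^\sigma_{(t)}=(x_i:\sigma(i)\le t)$ be the subsequence of those symbols $x_i$ with $\sigma(i)\le t$, ordered as in $x$. $\sigma$ is a proper building of $x$ if $x^\sigma_{(t)}$ is a proper coloring for each $t=1,\ldots,n$. $B(x)$ is the number of $\sigma\in S_n$ that are proper buildings of $x$. Definition of $Q$. Use the binary symbols $+$ $(=+1)$ and $-$ $(=-1)$, and identify the colors $1,2,3,4$ with the column vectors $\binom{-}{-},\binom{-}{+},\binom{+}{-},\binom{+}{+}$ respectively. Thus $x\in\{1,2,3,4\}^n$ becomes a $2\times n$ matrix $x=\binom{y}{z}$ with rows $y,z\in\{-,+\}^n$. For $y\in\{-,+\}^n$, $\alpha(y)$ is the number of permutations $\pi\in S_{n+1}$ such that, for each $1\le i\le n$, $\pi_i<\pi_{i+1}$ if $y_i=+$ and $\pi_i>\pi_{i+1}$ if $y_i=-$. A Dyck word of length $2k$ is an element of $\{-,+\}^{2k}$ comprising $k$ $+$'s and $k$ $-$'s such that the $i$th $+$ precedes the $i$th $-$ for each $i$. A dispersed Dyck word of length $m$ is an element of $\{-,0,+\}^m$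 that is a concatenation of Dyck words and strings of $0$'s. $\mathrm{DD}(m)$ is the set of dispersed Dyck words of length $m$ ($\mathrm{DD}(0)$ consists of the empty word), and $|w|$ is the number of $+$'s in $w$. A run of $y\in\{-,+\}^n$ is a maximal interval of constancy. If $y$ has $m$ runs and $w\in\mathrm{DD}(m-1)$, then $y_w\in\{-,+\}^n$ is the word obtained from $y$ by changing the signs of some whole runs of $y$, not including the first and last runs, in such a way that the $j$th sign-change (between the $j$th and $(j+1)$st runs of $y$) is eliminated precisely for those $j$ with $w_j\neq 0$. (So $y_w$ starts with the same sign as $y$, is constant on each run of $y$, and changes sign between the $j$th and $(j+1)$st runs of $y$ if and only if $w_j=0$.) For $y,z\in\{-,+\}^n$ with $y$ having $m$ runs, and $1\le j\le m-1$, let $\ell_j$ and $r_j$ be respectively the elements of $z$ immediately before and immediately after the $j$th sign-change in $y$ (i.e. the entries of $z$ at the position of the last element of the $j$th run of $y$ and at the position of the first element of the $(j+1)$st run). For $w\in \mathrm{DD}(m-1)$ let $$c(w,y,z)=\prod_{j=1}^{m-1}\begin{cases}\ell_j,& w_j=+;\\ r_j,& w_j=-;\\ 1,& w_j=0.\end{cases}$$ Finally, for $x=\binom{y}{z}\in\{1,2,3,4\}^n$, where $y$ has $m$ runs, $$Q(x)=\begin{cases}\displaystyle 2^{n-m}\sum_{w\in \mathrm{DD}(m-1)}(-1)^{|w|}\,c(w,y,z)\,\alpha(y_w) & \text{if } x \text{ is a proper coloring};\\ 0&\text{otherwise.}\end{cases}$$ *)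

(* Defs.v *)
From HB Require Import structures.
From mathcomp Require Import all_boot all_order all_algebra all_fingroup.

Set Implicit Arguments.
Unset Strict Implicit.
Unset Printing Implicit Defensive.

Import Order.TTheory GRing.Theory Num.Theory.

(* MathComp world. Positions, run indices and permutation values are 0-based. *)

Definition proper_coloring (T : eqType) (x : seq T) : bool :=
  sorted [rel a b | a != b] x.

(* [t : 'I_n] stands for the time t + 1 and the value [s i] for sigma(i) - 1,  *)
(* so that [s i <= t] is the condition sigma(i) <= t.                          *)
Definition subword (T : eqType) n (x : n.-tuple T) (s : 'S_n) (t : 'I_n) :
    seq T :=
  [seq tnth x i | i <- enum 'I_n & (s i <= t)%N].

Definition proper_building (T : eqType) n (x : n.-tuple T) (s : 'S_n) : bool :=
  [forall t : 'I_n, proper_coloring (subword x s t)].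

Definition B (T : eqType) n (x : n.-tuple T) : nat :=
  #|[set s : 'S_n | proper_building x s]|.

(* The symbols + and - are [true] and [false].                                 *)
Definition sgn (b : bool) : int := if b then 1%R else (-1)%R.

(* The rows (y, z) of a color: 1 = (-,-), 2 = (-,+), 3 = (+,-), 4 = (+,+);     *)
(* the values at other integers are irrelevant.                                *)
Definition color_y (c : int) : bool := c \in [:: 3; 4]%R.
Definition color_z (c : int) : bool := c \in [:: 2; 4]%R.

Definition alpha n (y : n.-tuple bool) : nat :=
  #|[set p : 'S_n.+1 | [forall i : 'I_n,
      let a := p (widen_ord (leqnSn n) i) in
      let b := p (lift ord0 i) in
      if tnth y i then (a < b)%N else (b < a)%N]]|.

(* Letters of {-,0,+}: [Some true] is +, [Some false] is -, [None] is 0.       *)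
Definition letter := option bool.

Definition positions (a : letter) (w : seq letter) : seq nat :=
  [seq i <- iota 0 (size w) | nth None w i == a].

(* [all2] also requires the two sequences to have the same length, i.e. there  *)
(* are as many +'s as -'s.                                                     *)
Definition dyck (w : seq letter) : bool :=
  (None \notin w)
  && all2 ltn (positions (Some true) w) (positions (Some false) w).

Definition dd_block (w : seq letter) : bool := dyck w || all (pred1 None) w.

(* The lengths of the blocks are bounded to keep the search finite; a          *)
(* concatenation has at most [size w] nonempty blocks, and empty blocks are    *)
(* allowed. See [dispersed_dyckP] for the unbounded characterization.          *)
Definition dispersed_dyck (w : seq letter) : bool :=
  [exists sh : (size w).-tuple 'I_(size w).+1,
     (sumn (map val sh) == size w) && all dd_block (reshape (map val sh) w)].

Lemma dispersed_dyckP (w : seq letter) :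
  reflect (exists2 ws : seq (seq letter), all dd_block ws & w = flatten ws)
          (dispersed_dyck w).
Proof.
apply: (iffP existsP) => [[sh /andP[/eqP sz_sh blk]] | [ws blk def_w]].
  exists (reshape (map val sh) w) => //.
  by rewrite reshapeKr // sz_sh.
pose vs := [seq v <- ws | v != [::]].
have flat_vs : flatten vs = w.
  rewrite def_w /vs; elim: ws {blk def_w vs} => //= v ws IH.
  by case: eqP => [-> | _] /=; rewrite IH.
have blk_vs : all dd_block vs.
  by rewrite all_filter; apply: sub_all blk => v /= ->; rewrite implybT.
have ne_vs : all (fun v => v != [::]) vs by rewrite filter_all.
have sz_vs : size vs <= size w.
  rewrite -flat_vs; elim: vs ne_vs {flat_vs blk_vs} => //= v vs IH /andP[v0 /IH].
  rewrite size_cat; case: v v0 => //= a v _ le.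
  by rewrite addSn ltnS (leq_trans le) // leq_addl.
pose us := vs ++ nseq (size w - size vs) [::].
have flat_us : flatten us = w.
  rewrite flatten_cat flat_vs; elim: (_ - _) => [|k IH] /=; first by rewrite cats0.
  exact: IH.
have blk_us : all dd_block us.
  by rewrite all_cat blk_vs; apply/allP => v /nseqP[->].
have sz_us : size (shape us) == size w.
  by rewrite size_map size_cat size_nseq subnKC.
have sum_us : sumn (shape us) = size w by rewrite -flat_us size_flatten.
have bnd k : k \in shape us -> k < (size w).+1.
  rewrite ltnS -sum_us; elim: (shape us) => //= a s IH.
  rewrite inE => /predU1P[-> | /IH le]; first exact: leq_addr.
  exact: leq_trans le (leq_addl _ _).
have sz_sh : size (map (inord : nat -> 'I_(size w).+1) (shape us)) == size w.
  by rewrite size_map.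
exists (Tuple sz_sh) => /=.
have -> : map val (map (inord : nat -> 'I_(size w).+1) (shape us)) = shape us.
  rewrite -map_comp -[RHS]map_id; apply/eq_in_map => k /bnd k_lt /=.
  by rewrite inordK.
by rewrite sum_us eqxx /= -[X in reshape _ X]flat_us flattenK.
Qed.

Definition DD (m : nat) : {set m.-tuple letter} :=
  [set w : m.-tuple letter | dispersed_dyck w].

Definition num_plus (w : seq letter) : nat := count_mem (Some true) w.

(* A pair (a, b) stands for the interval of positions a, a+1, ..., b.          *)
Definition intervals (n : nat) : seq (nat * nat) :=
  [seq (a, b) | a <- iota 0 n, b <- iota a (n - a)].

Definition constant_on (y : seq bool) (I : nat * nat) : bool :=
  constant (drop I.1 (take I.2.+1 y)).

Definition is_run (y : seq bool) (I : nat * nat) : bool :=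
  constant_on y I
  && all (fun J : nat * nat =>
            [&& J.1 <= I.1, I.2 <= J.2 & constant_on y J] ==> (J == I))
         (intervals (size y)).

(* [intervals] is lexicographically ordered, so the runs are listed from left  *)
(* to right.                                                                   *)
Definition runs (y : seq bool) : seq (nat * nat) :=
  [seq I <- intervals (size y) | is_run y I].

Definition num_runs (y : seq bool) : nat := size (runs y).

Definition left_of_change (y z : seq bool) (j : nat) : bool :=
  nth false z (nth (0, 0) (runs y) j).2.
Definition right_of_change (y z : seq bool) (j : nat) : bool :=
  nth false z (nth (0, 0) (runs y) j.+1).1.

(* The run containing position i is preceded by exactly k runs, separated by   *)
(* the first k sign-changes; eliminating a sign-change toggles whether the     *)
(* following runs are flipped, so this run is flipped iff an odd number of     *)
(* w_1, ..., w_k are nonzero.                                                  *)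
Definition flip_runs n (y : n.-tuple bool) (w : seq letter) : n.-tuple bool :=
  [tuple (let k := count (fun I : nat * nat => I.2 < i) (runs y) in
          tnth y i (+) odd (count (predC1 None) (take k w))) | i < n].

Local Open Scope ring_scope.

Definition c_weight (y z : seq bool) (w : (num_runs y).-1.-tuple letter) :
    int :=
  \prod_(j < (num_runs y).-1)
    match tnth w j with
    | Some true => sgn (left_of_change y z j)
    | Some false => sgn (right_of_change y z j)
    | None => 1
    end.

Definition Q n (x : n.-tuple int) : int :=
  let y := [tuple of map color_y x] in
  let z := [tuple of map color_z x] in
  if proper_coloring x then
    2 ^+ (n - num_runs y) *
    \sum_(w in DD (num_runs y).-1)
      (-1) ^+ num_plus w * c_weight z w * (alpha (flip_runs y w))%:Z
  else 0.

(* Main.v *)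
Require Import Defs.
From HB Require Import structures.
From mathcomp Require Import all_boot all_order all_algebra all_fingroup.
From mathcomp Require Import zify ring.

Set Implicit Arguments.
Unset Strict Implicit.
Unset Printing Implicit Defensive.

Import Order.TTheory GRing.Theory Num.Theory.
Local Open Scope ring_scope.

(** Removing the symbol that is placed last shows that, for a proper coloring
    [x], the number of proper buildings is the sum of the numbers of proper
    buildings of the words obtained by deleting one symbol of [x] ([B_rec]).
    The proof shows that the signed sum [Q] obeys the same recursion.

    Write [Q x] as a sum over the gaps between consecutive positions: a gap
    across which [y] is constant contributes a factor 2 (this is the power of 2
    in [Q]); a gap where [y] changes carries a letter 0, + or -, the letters
    being read as the steps of a path of nonnegative heights that uses 0 only at
    height 0 ([dispersed_dyckE]). The path determines a sign word [u] (the word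
    [y_w] of the definition), to which [alpha] is applied. All that is used of
    [alpha] is one identity ([pattern_count_gap]): removing the largest, or the
    smallest, value of a permutation gives, for a nonempty sign word [u],

      2 alpha(u) = alpha(u minus its first sign) + alpha(u minus its last sign)
        + the sum, over the sign changes of [u], of alpha(u minus the sign on
          the left of the change) + alpha(u minus the sign on its right).

    The right-hand side makes sense for an arbitrary function [f] of sign words,
    and the recursion holds for every such [f] ([gap_sum_deletion]). At a gap
    where [y] changes but [u] does not, the two neighbouring signs of [u] agree,
    so deleting the left one or the right one gives the same word; such a gap
    may therefore be charged with the difference of the two deletions. The sign
    of the difference is chosen so that, for the letter +, the left deletion
    comes with weight -1 and the right one with +1, and for the letter - the
    other way round. This imitates what deleting a symbol does to the weight
    [c]: when a run of [y] has length at least 2, the rows of a proper coloring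
    alternate in [z] along the run, so deleting the last symbol of the run
    changes the sign of the [l_j] that a letter + picks, and deleting the first
    one changes the sign of the [r_j] that a letter - picks.

    It remains to compare, for each deleted symbol [q] with neighbours [p] and
    [r], the contributions of the two gaps around it ([local_identity]). If [q]
    is interior to a run, both sides vanish, since [p = r]. If it is an end of a
    longer run the comparison is the one just made. If it is a run by itself,
    the nine pairs of letters have weights that cancel except for (0, 0) and
    (-, +), each of weight 2, and (+, -), of weight -2 times the [z]-entries of
    [p] and [r]. The first is possible exactly at height 0 and the second
    exactly at positive height, so the total is 2 (1 - p_z r_z) in all cases:
    4 if [p <> r] and 0 if [p = r]. The value 4 is right because the deletion
    merges two sign changes into a gap without sign change, of factor 2, and
    both sides of the recursion have been doubled. *)

(** * Deleting one symbol, and the recursion for proper buildings *)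

Definition delete_at (T : Type) (k : nat) (l : seq T) : seq T :=
  take k l ++ drop k.+1 l.

Definition insert_at (T : Type) (k : nat) (a : T) (l : seq T) : seq T :=
  take k l ++ a :: drop k l.

Lemma map_insert_at (T U : Type) (f : T -> U) k a l :
  map f (insert_at k a l) = insert_at k (f a) (map f l).
Proof. by rewrite /insert_at map_cat /= map_take map_drop. Qed.

Lemma map_delete_at (T U : Type) (f : T -> U) k l :
  map f (delete_at k l) = delete_at k (map f l).
Proof. by rewrite /delete_at map_cat map_take map_drop. Qed.

Lemma delete_insert_at (T : Type) k (a : T) l :
  (k <= size l)%N -> delete_at k (insert_at k a l) = l.
Proof.
move=> le_k; have sz : size (take k l) = k by rewrite size_takel.
rewrite /delete_at /insert_at take_cat drop_cat sz ltnn subnn take0 cats0.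
by rewrite ltnNge leqnSn /= subSnn /= drop0 cat_take_drop.
Qed.

Lemma filter_insert_at (T : Type) (P : pred T) k a l :
  ~~ P a -> filter P (insert_at k a l) = filter P l.
Proof.
by move=> /negPf Pa; rewrite filter_cat /= Pa -filter_cat cat_take_drop.
Qed.

(** Lets every list of values indexed by ['I_n.+1] be compared with the one
    indexed by ['I_n] that remains after removing an index. *)
Lemma enum_ord_insert n (k : 'I_n.+1) :
  enum 'I_n.+1 = insert_at k k [seq lift k j | j <- enum 'I_n].
Proof.
apply: (inj_map val_inj); rewrite val_enum_ord map_insert_at -map_comp.
have -> : [seq (val \o lift k) j | j <- enum 'I_n] = map (bump k) (iota 0 n).
  by rewrite -val_enum_ord -map_comp; apply: eq_map.
have le_k : (k <= n)%N by rewrite -ltnS.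
rewrite /insert_at -map_take -map_drop take_iota drop_iota (minn_idPl le_k) add0n.
have -> : map (bump k) (iota 0 k) = iota 0 k.
  rewrite -[RHS]map_id; apply/eq_in_map => i; rewrite mem_iota /= => lt_i.
  by rewrite /bump leqNgt lt_i.
have -> : map (bump k) (iota k (n - k)) = iota k.+1 (n - k).
  rewrite (iotaDl 1 k); apply/eq_in_map => i; rewrite mem_iota => /andP[le_i _].
  by rewrite /bump le_i.
by rewrite -[X in iota 0 X](subnKC (leqW le_k)) iotaD add0n subSn.
Qed.

(** A permutation is determined by the place of its largest value and by the
    relative order of the others. *)
Lemma sum_perm_max (n : nat) (F : 'S_n.+1 -> nat) :
  (\sum_(s : 'S_n.+1) F s =
   \sum_(k < n.+1) \sum_(s : 'S_n) F (lift_perm k ord_max s))%N.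
Proof.
rewrite (partition_big (fun s : 'S_n.+1 =>
  ((s^-1)%g : 'S_n.+1) ord_max) predT) //=.
apply: eq_bigr => k _.
have onto (s : 'S_n.+1) :
    (((s^-1)%g : 'S_n.+1) ord_max == k) = (s k == ord_max).
  by rewrite -(inj_eq (@perm_inj _ s)) permKV eq_sym.
have im_lift (s : 'S_n.+1) : s k == ord_max ->
    exists s' : 'S_n, lift_perm k ord_max s' = s.
  move=> /eqP sk; pose g j := odflt j (unlift ord_max (s (lift k j))).
  have gE j : lift ord_max (g j) = s (lift k j).
    rewrite /g; case: unliftP => //= e.
    have /perm_inj/eqP := etrans e (esym sk).
    by rewrite eq_sym (negPf (neq_lift _ _)).
  have g_inj : injective g.
    move=> i j e; apply: (@lift_inj _ k); apply: (@perm_inj _ s).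
    by rewrite -!gE e.
  exists (perm g_inj); apply/permP => j.
  case: (unliftP k j) => [i|] ->; first by rewrite lift_perm_lift permE gE.
  by rewrite lift_perm_id sk.
under eq_bigl => s do rewrite onto.
transitivity (\sum_(s in [set lift_perm k ord_max t | t : 'S_n]) F s)%N.
  apply: eq_bigl => s; apply/idP/imsetP => [/im_lift[t <-] | [t _ ->]].
    by exists t.
  by rewrite lift_perm_id.
rewrite big_imset //= => s t _ _ e; apply/permP => j.
by apply: (@lift_inj _ ord_max); rewrite -!(lift_perm_lift k) e.
Qed.

Definition tuple_delete (T : Type) n (x : n.+1.-tuple T) (k : 'I_n.+1) :
  n.-tuple T := [tuple tnth x (lift k j) | j < n].

Lemma tuple_deleteE (T : Type) n (x : n.+1.-tuple T) (k : 'I_n.+1) :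
  tuple_delete x k = delete_at k x :> seq T.
Proof.
have -> : val x = map (tnth x) (enum 'I_n.+1) by rewrite map_tnth_enum.
rewrite (enum_ord_insert k) map_insert_at delete_insert_at.
  by rewrite -map_comp.
by rewrite !size_map -enumT size_enum_ord -ltnS.
Qed.

Lemma subword_lift (T : eqType) n (x : n.+1.-tuple T) k (s : 'S_n) (t : 'I_n) :
  subword x (lift_perm k ord_max s) (lift ord_max t) =
  subword (tuple_delete x k) s t.
Proof.
rewrite /subword (enum_ord_insert k) filter_insert_at; last first.
  by rewrite lift_perm_id lift_max -ltnNge /=.
rewrite filter_map -map_comp.
have e : preim (lift k) (fun i => lift_perm k ord_max s i <= lift ord_max t)%N
    =1 (fun j => s j <= t)%N.
  by move=> j; rewrite [LHS]/(_ <= _)%N lift_perm_lift !lift_max.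
rewrite (eq_filter e).
by apply: eq_map => j /=; rewrite tnth_mktuple.
Qed.

Lemma subword_max (T : eqType) n (x : n.+1.-tuple T) s :
  subword x s ord_max = x.
Proof.
rewrite /subword (@eq_filter _ _ predT) ?filter_predT ?map_tnth_enum //.
by move=> i; apply: leq_ord.
Qed.

(** The place of the largest value of a permutation is the symbol placed last:
    at the last time the whole word is visible, and before it the building is
    a building of the word without that symbol. *)
Lemma B_rec (T : eqType) n (x : n.+1.-tuple T) :
  B x = if proper_coloring x then (\sum_(k < n.+1) B (tuple_delete x k))%N
        else 0%N.
Proof.
have B_sum m (u : m.-tuple T) : B u = (\sum_(s : 'S_m) proper_building u s)%N.
  by rewrite /B -sum1dep_card big_mkcond.
rewrite B_sum sum_perm_max.
under [X in if _ then X else _]eq_bigr do rewrite B_sum.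
have PB k s : proper_building x (lift_perm k ord_max s) =
    proper_coloring x && proper_building (tuple_delete x k) s.
  apply/forallP/andP => [all_t | [px /forallP all_t] t].
    split; first by have := all_t ord_max; rewrite subword_max.
    by apply/forallP => t; have := all_t (lift ord_max t); rewrite subword_lift.
  by case: (unliftP ord_max t) => [u|] ->; rewrite ?subword_lift ?subword_max.
under [LHS]eq_bigr => k _ do under eq_bigr => s _ do rewrite PB.
by case: ifP => // _; rewrite big1 // => k _; rewrite big1.
Qed.

Lemma B_nil (T : eqType) (x : 0.-tuple T) : B x = 1%N.
Proof.
rewrite /B (_ : [set s | _] = setT) ?cardsT ?card_perm ?card_Sn //.
by apply/setP => s; rewrite !inE; apply/forallP => -[].
Qed.

(** * Signed sums over letters on the gaps *)

Definition color := (bool * bool)%type.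

Definition drop_last (T : Type) (l : seq T) : seq T :=
  if l is a :: l' then belast a l' else [::].

(** One gap of the signed sum, between the colors [p] and [q], for a path that
    arrives at height [h] and with the current sign [s] of [y_w]; [g] gives the
    contribution of the rest of the word. The sign of [(-1) ^+ |w|] is carried by
    the letters +. *)
Definition step (h : nat) (s : bool) (p q : color) (g : nat -> bool -> int) :=
  if p.1 == q.1 then 2 * g h s else
  (if h is h'.+1 then sgn q.2 * g h' s else g 0%N (~~ s)) - sgn p.2 * g h.+1 s.

(** The signed sum over the letters on the gaps of [p :: x], with [f] in place of
    [alpha]. Passing [f] as a continuation keeps the sum linear in [f] while the
    sign word is being built from left to right. *)
Fixpoint transfer (h : nat) (s : bool) (p : color) (x : seq color)
    (f : seq bool -> int) : int :=
  if x is q :: x' then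
    step h s p q (fun h' s' => transfer h' s' q x' (fun u => f (s :: u)))
  else if h is 0 then f [:: s] else 0.

(** This is [Q] on proper colorings when [f] is [alpha]; see [Q_transfer]. *)
Definition gap_sum (x : seq color) (f : seq bool -> int) : int :=
  if x is p :: x' then transfer 0 p.1 p x' f else f [::].

(** The deletions on either side of the sign changes of [u], inserted in [f]; the
    sign words [u] are traversed from the left, as in [transfer]. *)
Fixpoint gap_deletions (f : seq bool -> int) (u : seq bool) : int :=
  if u is a :: u' then
    if u' is b :: u'' then
      (if a == b then 0 else f u' + f (a :: u'')) +
      gap_deletions (fun v => f (a :: v)) u'
    else 0
  else 0.

(** The continuation only receives words that start with the current sign. *)
Lemma eq_transfer h s p x f g :
  (forall u, f (s :: u) = g (s :: u)) ->
  transfer h s p x f = transfer h s p x g.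
Proof.
elim: x h s p f g => [|q x IH] h s p f g fg /=; first by case: h.
have e h' s' : transfer h' s' q x (fun u => f (s :: u)) =
               transfer h' s' q x (fun u => g (s :: u)).
  by apply: IH => u; apply: fg.
by rewrite /step; case: ifP => _; case: h => [|h]; rewrite !e.
Qed.

Lemma transferD h s p x f g :
  transfer h s p x (fun u => f u + g u) =
  transfer h s p x f + transfer h s p x g.
Proof.
elim: x h s p f g => [|q x IH] h s p f g /=; first by case: h; rewrite ?addr0.
rewrite /step; case: ifP => _; case: h => [|h]; rewrite !IH; ring.
Qed.

Lemma transferZ c h s p x f :
  transfer h s p x (fun u => c * f u) = c * transfer h s p x f.
Proof.
elim: x h s p f => [|q x IH] h s p f /=; first by case: h; rewrite ?mulr0.
rewrite /step; case: ifP => _; case: h => [|h]; rewrite !IH; ring.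
Qed.

(** The contribution of deleting [p] that is charged to the gap on its right: as
    in [transfer] with [p] left out of the sign word, but a letter + comes with
    the opposite sign, so that at a gap where [y_w] does not change this cancels
    against the contribution of deleting the right neighbour. When no
    gap is left, it is the contribution of deleting the last symbol of the word. *)
Definition transfer_without_first h s (p : color) x
    (f : seq bool -> int) : int :=
  if x is q :: x' then
    if p.1 == q.1 then 0 else
    (if h is h'.+1 then sgn q.2 * transfer h' s q x' f
     else transfer 0 (~~ s) q x' f) + sgn p.2 * transfer h.+1 s q x' f
  else if h is 0 then f [::] else 0.

Definition deletion_sum h s (p : color) x f : int :=
  \sum_(i < size x) if proper_coloring (p :: delete_at i x)
                    then transfer h s p (delete_at i x) f else 0.

Lemma deletion_sum_cons h s (p q : color) x f : p != q ->
  deletion_sum h s p (q :: x) f =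
  (if proper_coloring (p :: x) then transfer h s p x f else 0) +
  step h s p q (fun h' s' => deletion_sum h' s' q x (fun u => f (s :: u))).
Proof.
move=> pq; rewrite /deletion_sum big_ord_recl /= /delete_at take0 drop1 /=.
congr (_ + _); rewrite /step /=.
under eq_bigr do rewrite pq /=.
by case: ifP => _; [|case: h => [|h]]; rewrite ?mulr_sumr -?sumrB;
  apply: eq_bigr => i _; case: ifP => _; rewrite ?mulr0 ?subr0.
Qed.

(** Comparison of the contributions of deleting [q]. On the left, the first
    sum lists the two deletions at the gap between [p] and [q] when it is a
    change of [y_w], and the second one is charged to the gap after [q]; on the
    right, the deletion of [p] is charged to the gap between [p] and [q], and the
    rest of the gap must give twice the signed sum of the word without [q]. The
    height only matters through whether it is 0, 1 or larger, since a single
    letter leads to or from height 0. *)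
Lemma local_identity h s (p q : color) x f :
  p != q -> proper_coloring (q :: x) ->
  step h s p q (fun h' s' => if s == s' then 0 else
    transfer h' s' q x f + transfer h' s' q x (fun u => f (s :: behead u))) +
  step h s p q (fun h' s' =>
    transfer_without_first h' s' q x (fun u => f (s :: u))) =
  transfer_without_first h s p (q :: x) f +
  2 * (if proper_coloring (p :: x) then transfer h s p x f else 0).
Proof.
case: x => [|r x]; case: p q => [p1 p2] [q1 q2] pq.
  (* [q] is the last symbol *)
  move=> _; case: p1 p2 q1 q2 s pq => -[] [] [] [] //= _;
    case: h => [|[|h]] /=; rewrite /step /=; ring.
case: r => r1 r2 /= /andP[qr ->]; rewrite andbT.
(* Once the colors and the sign are known, both sides are combinations of the
   same transfers from [r] onwards. *)
case: p1 q1 r1 s p2 q2 r2 pq qr => -[] [] [] [] [] [] //= _ _;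
case: h => [|[|h]] /=; rewrite /step /=; ring.
Qed.

Lemma stepD h s p q F G :
  step h s p q (fun h' s' => F h' s' + G h' s') =
  step h s p q F + step h s p q G.
Proof. rewrite /step; case: ifP => _; case: h => [|h]; ring. Qed.

Lemma stepZ c h s p q F :
  step h s p q (fun h' s' => c * F h' s') = c * step h s p q F.
Proof. rewrite /step; case: ifP => _; case: h => [|h]; ring. Qed.

Lemma eq_step h s p q F G : F =2 G -> step h s p q F = step h s p q G.
Proof.
by move=> e; rewrite /step; case: ifP => _; case: h => [|h]; rewrite !e.
Qed.

(** By induction, the deletions of the symbols after [p] are collected, while the
    left half of the weight of the first gap is kept for the deletion of [p]. *)
Lemma transfer_gap_deletions h s p x f : proper_coloring (p :: x) ->
  transfer h s p x (gap_deletions f) +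
    transfer h s p x (fun u => f (drop_last u)) =
  transfer_without_first h s p x f + 2 * deletion_sum h s p x f.
Proof.
elim: x h s p f => [|q x IH] h s p f.
  by rewrite /deletion_sum big_ord0 /=; case: h => *; rewrite ?mulr0 ?addr0 ?add0r.
move=> /= /andP[pq px]; rewrite deletion_sum_cons // mulrDr addrA.
rewrite -(local_identity _ _ _ pq px) -stepZ -!stepD.
apply: eq_step => h' s'; rewrite -addrA -IH // !addrA.
have -> : transfer h' s' q x (fun u => f (drop_last (s :: u))) =
          transfer h' s' q x (fun u => f (s :: drop_last u)).
  by apply: eq_transfer.
congr (_ + _).
have -> : transfer h' s' q x (fun u => gap_deletions f (s :: u)) =
  transfer h' s' q x (fun u =>
    (if s == s' then 0 else f u + f (s :: behead u)) +
    gap_deletions (fun v => f (s :: v)) u).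
  by apply: eq_transfer.
rewrite transferD; congr (_ + _); case: ifP => _; last by rewrite transferD.
by rewrite -(mul0r 0) transferZ mul0r.
Qed.

(** The recursion for the signed sum with an arbitrary function of sign words; it
    completes the previous lemma by the deletion of the first symbol. *)
Lemma gap_sum_deletion (x : seq color) f : x != [::] -> proper_coloring x ->
  gap_sum x (fun u => f (behead u) + (f (drop_last u) + gap_deletions f u)) =
  2 * \sum_(i < size x) if proper_coloring (delete_at i x)
                         then gap_sum (delete_at i x) f else 0.
Proof.
case: x => // p x _ px; rewrite big_ord_recl /= {1 2}/delete_at take0 drop1 /=.
have px' : proper_coloring x := path_sorted px; rewrite px' mulrDr.
have -> : \sum_(i < size x) (if proper_coloring (delete_at (bump 0 i) (p :: x))
     then gap_sum (delete_at (bump 0 i) (p :: x)) f else 0) =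
  deletion_sum 0 p.1 p x f by [].
rewrite !transferD [X in _ + X]addrC transfer_gap_deletions // addrA; congr (_ + _).
case: x px {px'} => [|q x] /=; first by move=> _; ring.
case: p q => [[] p2] [[] q2] /= _; rewrite /step /=; ring.
Qed.

(** * Counting permutations by their ascents and descents *)

Fixpoint has_signs (y : seq bool) (l : seq nat) : bool :=
  match y, l with
  | b :: y', u :: (v :: _) as l' =>
    (if b then u < v else v < u)%N && has_signs y' l'
  | [::], [:: _] => true
  | _, _ => false
  end.

Definition pattern_count (y : seq bool) : int := (alpha (in_tuple y))%:Z.

Lemma pattern_countE n (y : n.-tuple bool) : (alpha y)%:Z = pattern_count y.
Proof.
case: y => y sz; have := eqP sz => e; subst n.
by rewrite /pattern_count; congr (alpha _)%:Z; apply: val_inj.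
Qed.

Definition values n (s : 'S_n) : seq nat := [seq val (s i) | i <- enum 'I_n].

Lemma has_signsP y l : size l = (size y).+1 ->
  reflect (forall i, (i < size y)%N ->
     if nth true y i then (nth 0 l i < nth 0 l i.+1)%N
     else (nth 0 l i.+1 < nth 0 l i)%N) (has_signs y l).
Proof.
elim: y l => [|b y IH] [|u [|v l]] //= sz.
  by apply: (iffP idP).
have {}IH := IH (v :: l) (eq_add_S _ _ sz).
apply: (iffP andP) => [[c /IH all_i] [|i] // /all_i // | all_i].
split; first exact: (all_i 0%N).
by apply/IH => i; apply: (all_i i.+1).
Qed.

Lemma pattern_count_sum n (y : n.-tuple bool) :
  alpha y = (\sum_(s : 'S_n.+1) has_signs y (values s))%N.
Proof.
rewrite /alpha -sum1dep_card big_mkcond /=; apply: eq_bigr => s _.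
congr nat_of_bool.
have nthv i (lt_i : (i < n.+1)%N) : nth 0%N (values s) i = s (Ordinal lt_i).
  rewrite (nth_map (Ordinal lt_i)) ?size_enum_ord //; congr (val (s _)).
  by apply: val_inj; rewrite /= nth_enum_ord.
have sz : size (values s) = (size y).+1 by rewrite size_map size_enum_ord size_tuple.
have gap i (lt_i : (i < n)%N) :
    [/\ nth 0%N (values s) i = s (widen_ord (leqnSn n) (Ordinal lt_i)),
        nth 0%N (values s) i.+1 = s (lift ord0 (Ordinal lt_i)) &
        nth true y i = tnth y (Ordinal lt_i)].
  rewrite (nthv i (leqW lt_i)) (nthv i.+1 lt_i) (tnth_nth true).
  by split=> //; congr (val (s _)); apply: val_inj.
apply/forallP/(has_signsP sz) => [all_i i | all_i [i lt_i]].
  by rewrite size_tuple => lt_i; have [-> -> ->] := gap i lt_i; apply: all_i.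
have := all_i i; rewrite size_tuple => /(_ lt_i).
by have [-> -> ->] := gap i lt_i.
Qed.

Lemma pattern_count_nil : pattern_count [::] = 1.
Proof.
rewrite /pattern_count pattern_count_sum /=.
rewrite (eq_bigr (fun _ => 1%N)) => [|s _].
  by rewrite sum_nat_const muln1 card_Sn.
by rewrite /values enum_ordSl /= (size0nil (size_enum_ord 0)).
Qed.

Lemma values_lift n (k : 'I_n.+1) (s : 'S_n) :
  values (lift_perm k ord_max s) = insert_at k n (values s).
Proof.
rewrite /values {1}(enum_ord_insert k) map_insert_at lift_perm_id -map_comp.
congr insert_at; apply: eq_map => j /=.
by rewrite lift_perm_lift lift_max.
Qed.

(** Complementing the values of a permutation exchanges its largest and smallest
    values, which reduces the removal of the smallest to that of the largest. *)
Lemma values_complement n (s : 'S_n) y : size y = n.-1 ->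
  has_signs y (values (s * perm (@rev_ord_inj n))%g) =
  has_signs (map negb y) (values s).
Proof.
case: n s => [|n] s sz.
  by rewrite /values (size0nil (size_enum_ord 0)) /=; case: y sz.
have cmp (u v : 'I_n.+1) : (rev_ord u < rev_ord v)%N = (v < u)%N.
  by have := ltn_ord u; have := ltn_ord v => /=; lia.
rewrite /values; elim: y (enum _) {sz} => [|b y IH] [|i [|j l]] //=.
rewrite (IH (j :: l)); congr (_ && _).
by rewrite !permM !permE /= !cmp; case: b.
Qed.

Lemma pattern_count_neg y : pattern_count (map negb y) = pattern_count y.
Proof.
rewrite -(pattern_countE (map_tuple negb (in_tuple y))) /pattern_count.
rewrite !pattern_count_sum /=.
rewrite (reindex_inj (mulIg (perm (@rev_ord_inj (size y).+1)))) /=.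
congr Posz; apply: eq_bigr => s _.
by rewrite values_complement ?size_map // (mapK negbK).
Qed.

(** The words that describe what remains after removing the largest value, unless
    this value comes first. *)
Fixpoint max_deletions (f : seq bool -> int) (u : seq bool) : int :=
  if u is a :: u' then
    if u' is b :: u'' then
      (if a && ~~ b then f u' + f (a :: u'') else 0) +
      max_deletions (fun v => f (a :: v)) u'
    else (if a then f [::] else 0)
  else 0.

Lemma max_deletions_sum (I : Type) (r : seq I) F u :
  max_deletions (fun v => \sum_(i <- r) F i v) u =
  \sum_(i <- r) max_deletions (F i) u.
Proof.
elim: u F => [|a [|b u] IH] F /=; first by rewrite big1.
  by case: a => //; rewrite big1.
rewrite big_split /=; have /= -> := IH (fun i v => F i (a :: v)); congr (_ + _).
by case: ifP => _; rewrite -?big_split // big1.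
Qed.

Lemma eq_max_deletions f g u :
  (forall v, (size v).+1 = size u -> f v = g v) ->
  max_deletions f u = max_deletions g u.
Proof.
elim: u f g => [|a [|b u] IH] f g fg //=; first by rewrite fg.
have /= -> := IH (fun v => f (a :: v)) (fun v => g (a :: v)).
  by rewrite !fg.
by move=> v [sv]; apply: fg; rewrite /= sv.
Qed.

Lemma max_deletionsZ c f u :
  max_deletions (fun v => c * f v) u = c * max_deletions f u.
Proof.
elim: u f => [|a [|b u] IH] f /=; first by rewrite mulr0.
  by case: a; rewrite ?mulr0.
by have /= -> := IH (fun v => f (a :: v)); case: ifP => _; ring.
Qed.

(** Away from the front, a largest value must sit at the end of the list or at a
    change from + to -; when it is removed from there, the two signs around it
    are replaced by the sign of the comparison of its neighbours, which is + or -
    but not both. *)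
Lemma has_signs_insert_max y l M :
  uniq l -> all (ltn^~ M) l -> size y = size l -> y != [::] ->
  \sum_(k < size l) (has_signs y (insert_at k.+1 M l))%:Z =
  max_deletions (fun v => (has_signs v l)%:Z) y.
Proof.
elim: y l => [|b y IH] [|u l] //= /andP[ul uq] /andP[uM lM] [sz] _.
rewrite big_ord_recl /=.
case: y l sz IH ul uq lM => [|b' y] [|v l] // sz IH ul uq lM.
  by rewrite big_ord0 /= uM addr0 andbT; case: b => //; rewrite ltnNge ltnW.
rewrite /=; have vM : (v < M)%N by case/andP: lM.
congr (_ + _).
  rewrite uM vM ![(M < _)%N]ltnNge (ltnW uM) (ltnW vM) /=.
  move: ul; rewrite inE => /norP[uv _].
  by case: (b) (b') => [] [] //=; case: (ltngtP u v) uv => //; rewrite ?add0r ?addr0.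
have IHvl : \sum_(k < (size l).+1)
    (has_signs (b' :: y) (insert_at k.+1 M (v :: l)))%:Z =
    max_deletions (fun w => (has_signs w (v :: l))%:Z) (b' :: y).
  exact: (IH (v :: l) uq lM sz isT).
transitivity ((if b then (u < v)%N else (v < u)%N)%:Z *
    \sum_(k < (size l).+1) (has_signs (b' :: y) (insert_at k.+1 M (v :: l)))%:Z).
  rewrite mulr_sumr; under [RHS]eq_bigr => i _ do rewrite -PoszM mulnb.
  by [].
rewrite IHvl // -max_deletionsZ.
transitivity (max_deletions (fun w => (has_signs (b :: w) [:: u, v & l])%:Z) (b' :: y)) => //.
apply: eq_max_deletions => w _ /=.
by rewrite -PoszM mulnb.
Qed.

Lemma pattern_count_peak b y :
  pattern_count (b :: y) =
  (if b then 0 else pattern_count y) + max_deletions pattern_count (b :: y).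
Proof.
rewrite {1}/pattern_count pattern_count_sum sum_perm_max big_ord_recl.
set n := size y.
have alphaE v : (size v).+1 = size (b :: y) ->
    pattern_count v = \sum_(s : 'S_n.+1) (has_signs v (values s))%:Z.
  move=> [sv]; have sz : size v == n by rewrite sv.
  by rewrite -(pattern_countE (Tuple sz)) pattern_count_sum -raddf_sum.
have val_lt (s : 'S_n.+1) : all (ltn^~ n.+1) (values s).
  by apply/allP => i /mapP[j _ ->] /=.
have sz_val (s : 'S_n.+1) : size (values s) = n.+1 by rewrite size_map size_enum_ord.
rewrite PoszD; congr (_ + _).
  case: ifP => bb.
    rewrite big1 // => s _; rewrite values_lift /insert_at take0 drop0 /=.
    case: (values s) (val_lt s) => //= u l /andP[uM _].
    by rewrite ltnNge ltnW.
  rewrite alphaE // raddf_sum; apply: eq_bigr => s _.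
  rewrite values_lift /insert_at take0 drop0 /=.
  case: (values s) (val_lt s) (sz_val s) => //= u l /andP[uM _].
  by rewrite uM.
rewrite (eq_max_deletions alphaE) max_deletions_sum exchange_big raddf_sum.
apply: eq_bigr => s _; rewrite -(@has_signs_insert_max _ _ n.+1) ?sz_val //.
  rewrite raddf_sum; apply: eq_bigr => k _; by rewrite values_lift.
rewrite map_inj_uniq ?enum_uniq // => i j e; exact: (perm_inj (val_inj e)).
Qed.

(** A change from + to - is where the largest value can sit, a change from - to +
    is where the smallest one can. *)
Lemma gap_max_deletions f b u :
  f (drop_last (b :: u)) + gap_deletions f (b :: u) =
  max_deletions f (b :: u) +
  max_deletions (fun v => f (map negb v)) (map negb (b :: u)).
Proof.
elim: u b f => [|a u IH] b f /=.
  by case: b; rewrite !addr0 ?add0r.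
have := IH a (fun v => f (b :: v)) => /= IHa.
rewrite addrCA IHa !negbK (mapK negbK).
by case: a b {IH IHa} => [] [] /=; ring.
Qed.

(** Adds up the removal of the largest and of the smallest value. *)
Lemma pattern_count_gap y : y != [::] ->
  pattern_count (behead y) +
    (pattern_count (drop_last y) + gap_deletions pattern_count y) =
  2 * pattern_count y.
Proof.
case: y => // b y _; rewrite gap_max_deletions.
have e1 := pattern_count_peak b y.
have e2 : pattern_count (b :: y) = (if ~~ b then 0 else pattern_count y) +
    max_deletions pattern_count (map negb (b :: y)).
  rewrite -(pattern_count_neg (b :: y)) pattern_count_peak.
  by rewrite pattern_count_neg.
have -> : max_deletions (fun v => pattern_count (map negb v)) (map negb (b :: y)) =
    max_deletions pattern_count (map negb (b :: y)).
  by apply: eq_max_deletions => v _; rewrite pattern_count_neg.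
rewrite mulr_natl mulr2n {1}e1 e2 /=; case: (b); rewrite /=; ring.
Qed.

(** * Dispersed Dyck words as height paths, and runs by recursion *)

Fixpoint dd_path (h : nat) (w : seq letter) : bool :=
  match w with
  | [::] => h == 0%N
  | None :: w' => (h == 0%N) && dd_path 0 w'
  | Some true :: w' => dd_path h.+1 w'
  | Some false :: w' => if h is h'.+1 then dd_path h' w' else false
  end.

Lemma positions_cons a c w k :
  map (addn k) (positions a (c :: w)) =
  (if c == a then [:: k] else [::]) ++ map (addn k.+1) (positions a w).
Proof.
rewrite /positions /= (iotaDl 1 0) filter_map -[RHS]/(_ ++ _).
have e : map (addn k) (map (addn 1) [seq i <- iota 0 (size w) | nth None w i == a]) =
  map (addn k.+1) [seq i <- iota 0 (size w) | nth None w i == a].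
  by rewrite -map_comp; apply: eq_map => i /=; rewrite addnA addn1.
by case: eqP => _ /=; rewrite e ?addn0.
Qed.

(** The list [P] holds the positions of the letters + that are still to be
    matched, so that its length is the current height; all that matters of them
    is that they precede the remaining word, whose positions start at [k]. *)
Lemma dyck_dd_path h w k P : None \notin w -> size P = h -> all (ltn^~ k) P ->
  all2 ltn (P ++ map (addn k) (positions (Some true) w))
           (map (addn k) (positions (Some false) w)) = dd_path h w.
Proof.
elim: w h k P => [|a w IH] h k P; first by move=> _ <- _; case: P.
rewrite inE negb_or => /andP[a0 w0] szP ltP.
have ltP' : all (ltn^~ k.+1) P by apply: sub_all ltP => i; apply: leqW.
case: a a0 => [[]|] // _; rewrite !positions_cons /=.
  by rewrite -cat_rcons (IH h.+1) ?size_rcons ?szP // all_rcons ltP' andbT /= leqnn.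
case: P szP ltP ltP' => [|i P] /= <- => [_ _ | /andP[ik _] /andP[_ ltP']].
  case: (positions (Some true) w) => //= i l.
  by rewrite addSnnS ltnNge leq_addr.
by rewrite ik (IH (size P)).
Qed.

Lemma dyckE w : dyck w = (None \notin w) && dd_path 0 w.
Proof.
rewrite /dyck; case w0: (None \notin w) => //=.
have /= <- := @dyck_dd_path 0 w 0 [::] w0 erefl isT.
by rewrite !map_id_in.
Qed.

Lemma dd_path_cat h u v : dd_path h u -> dd_path 0 v -> dd_path h (u ++ v).
Proof.
move=> + pv; elim: u h => [|[[]|] u IH] h /=; first by move/eqP->.
- exact: IH.
- by case: h => // h; apply: IH.
- by case/andP=> -> /IH.
Qed.

(** A path at positive height is inside a Dyck block, so the letters up to the
    next 0 have to be set aside when a path is cut into blocks. *)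
Lemma dispersed_dyckE w : dispersed_dyck w = dd_path 0 w.
Proof.
apply/dispersed_dyckP/idP => [[ws blk ->] | ].
  elim: ws blk => //= v ws IH /andP[bv /IH]; apply: dd_path_cat.
  case/orP: bv => [| /all_pred1P ->]; first by rewrite dyckE => /andP[].
  by elim: (size v).
suff split h : dd_path h w -> exists u ws,
    [/\ w = u ++ flatten ws, None \notin u, dd_path h u & all dd_block ws].
  case/split=> u [ws [-> u0 pu blk]]; exists (u :: ws) => //=.
  by rewrite blk /dd_block dyckE u0 pu.
elim: w h => [|[[]|] w IH] h /=.
- by move=> h0; exists [::], [::].
- move=> /IH[u [ws [-> u0 pu blk]]]; by exists (Some true :: u), ws.
- case: h => // h /IH[u [ws [-> u0 pu blk]]]; by exists (Some false :: u), ws.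
- case/andP=> /eqP-> /IH[u [ws [-> u0 pu blk]]].
  exists [::], ([:: None] :: u :: ws); split=> //=.
  by rewrite blk /dd_block dyckE u0 pu.
Qed.

Definition shift (I : nat * nat) : nat * nat := (I.1.+1, I.2.+1).

Lemma intervals_succ n :
  intervals n.+1 = [seq (0%N, c) | c <- iota 0 n.+1] ++ map shift (intervals n).
Proof.
rewrite /intervals /=; congr (_ :: _ ++ _).
rewrite (iotaDl 1 0) -map_comp map_flatten -map_comp; congr flatten.
apply: eq_map => a /=; rewrite subSS (iotaDl 1 a) -!map_comp.
exact: eq_map.
Qed.

Lemma mem_intervals n I : (I \in intervals n) = (I.1 <= I.2 < n)%N.
Proof.
case: I => a c; apply/allpairsPdep/andP => /= [[i [j []]] | [ac cn]].
  by rewrite !mem_iota => ? ? [-> ->]; lia.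
by exists a, c; rewrite !mem_iota; split=> //; lia.
Qed.

Lemma is_runP y I : reflect (constant_on y I /\
    forall a c, (a <= c < size y)%N -> (a <= I.1)%N -> (I.2 <= c)%N ->
      constant_on y (a, c) -> (a, c) = I) (is_run y I).
Proof.
apply: (iffP andP) => [[-> /allP mx] | [-> mx]]; split=> //.
  move=> a c ac aI Ic cst; apply/eqP.
  by have := mx (a, c); rewrite mem_intervals aI Ic cst => /(_ ac).
apply/allP => -[a c]; rewrite mem_intervals /= => ac.
by apply/implyP => /and3P[aI Ic cst]; apply/eqP/mx.
Qed.

Lemma constant_on_cons b y I : constant_on (b :: y) (shift I) = constant_on y I.
Proof. by []. Qed.

Lemma constant_on0S b b' y c :
  constant_on [:: b, b' & y] (0%N, c.+1) =
  (b == b') && constant_on (b' :: y) (0%N, c).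
Proof. by rewrite /constant_on /= eq_sym; case: eqP => // ->. Qed.

Lemma constant_on00 b y : constant_on (b :: y) (0%N, 0%N).
Proof. by rewrite /constant_on /= take0. Qed.

Fixpoint runs_rec (b : bool) (y : seq bool) : seq (nat * nat) :=
  if y is b' :: y' then
    let r := map shift (runs_rec b' y') in
    if b == b' then (0%N, (head (0%N, 0%N) r).2) :: behead r else (0%N, 0%N) :: r
  else [:: (0%N, 0%N)].

Lemma runs_rec_head b y : exists c t,
  runs_rec b y = (0%N, c) :: t /\ all (fun I => I.1 != 0%N) t.
Proof.
elim: y b => [|b' y IH] b /=; first by exists 0%N, [::].
have [c [t [-> t0]]] := IH b'.
have t0' : all (fun I => I.1 != 0%N) (map shift t).
  by rewrite all_map; apply/allP.
by case: eqP => _; [exists c.+1, (map shift t)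
                   | exists 0%N, (shift (0%N, c) :: map shift t)].
Qed.

Lemma is_run_change b b' y I : b != b' ->
  is_run [:: b, b' & y] (shift I) = is_run (b' :: y) I.
Proof.
move=> bb'; apply/is_runP/is_runP => -[cst mx]; split=> // a c.
  move=> ac aI Ic cac; have := mx a.+1 c.+1; rewrite -[(a.+1, c.+1)]/(shift (a, c)).
  by rewrite constant_on_cons => /(_ ac aI Ic cac) [-> ->]; case: (I).
case: a c => [|a] [|c] //= ac aI Ic; first by rewrite constant_on0S (negPf bb').
by move=> cac; rewrite -(mx a c).
Qed.

Lemma is_run_change0 b b' y c : b != b' ->
  is_run [:: b, b' & y] (0%N, c) = (c == 0%N).
Proof.
move=> bb'; case: c => [|c]; last first.
  by apply/is_runP => -[]; rewrite constant_on0S (negPf bb').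
apply/is_runP; split=> [|a c]; first exact: constant_on00.
rewrite /= leqn0 => _ /eqP-> _; case: c => // c.
by rewrite constant_on0S (negPf bb').
Qed.

(** Adding a copy of the first symbol in front keeps a run maximal unless it is
    the first one, which then gets one symbol longer. *)
Lemma is_run_same b y I : (I.2 <= size y)%N ->
  is_run [:: b, b & y] (shift I) = is_run (b :: y) I && (I.1 != 0%N).
Proof.
move=> ltI; apply/is_runP/andP => -[].
  move=> cst mx; split.
    apply/is_runP; split=> // a c ac aI Ic cac; have := mx a.+1 c.+1.
    rewrite -[(a.+1, c.+1)]/(shift (a, c)) constant_on_cons.
    by move=> /(_ ac aI Ic cac) [-> ->]; case: (I).
  apply/negP => /eqP I0; have := mx 0%N I.2.+1; rewrite constant_on0S eqxx /=.
  move: cst; rewrite constant_on_cons [I in constant_on _ I]surjective_pairing I0.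
  by move=> cst /(_ ltI isT (leqnn _) cst).
move=> /is_runP[cst mx] I0; split=> // -[|a] [|c] //= ac aI Ic.
  rewrite constant_on0S eqxx /= => cc.
  by move: I0; rewrite -(mx 0%N c).
by move=> cac; rewrite -(mx a c).
Qed.

Lemma is_run_same0 b y c :
  is_run [:: b, b & y] (0%N, c.+1) = is_run (b :: y) (0%N, c).
Proof.
apply/is_runP/is_runP; rewrite constant_on0S eqxx /= => -[cst mx]; split=> // a d.
  rewrite leqn0 => /= ad /eqP a0 cd cad; subst a.
  by have := mx 0%N d.+1; rewrite constant_on0S eqxx /= => /(_ ad isT cd cad) [->].
rewrite leqn0 => /= + /eqP a0; subst a; case: d => // d ad cd.
by rewrite constant_on0S eqxx /= => cad; have [->] := mx 0%N d ad isT cd cad.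
Qed.

Lemma is_run_same00 b y : is_run [:: b, b & y] (0%N, 0%N) = false.
Proof.
apply/is_runP => -[_ mx]; have := mx 0%N 1%N isT isT isT.
by rewrite constant_on0S eqxx constant_on00 => /(_ isT).
Qed.

Lemma runs_split b y :
  runs (b :: y) =
  [seq I <- [seq (0%N, c) | c <- iota 0 (size y).+1] | is_run (b :: y) I] ++
  map shift [seq I <- intervals (size y) | is_run (b :: y) (shift I)].
Proof.
by rewrite /runs intervals_succ filter_cat; congr (_ ++ _); rewrite filter_map.
Qed.

(** Reading [y] from the left matches the recursive definition of the signed sum,
    unlike the search for maximal intervals. *)
Lemma runsE b y : runs (b :: y) = runs_rec b y.
Proof.
elim: y b => [|b' y IH] b; first by case: b.
rewrite runs_split [runs_rec _ _]/= -IH.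
case: eqP => [e|/eqP bb']; last first.
  have -> : [seq I <- [seq (0%N, c) | c <- iota 0 (size (b' :: y)).+1]
               | is_run [:: b, b' & y] I] = [:: (0%N, 0%N)].
    rewrite filter_map (eq_filter (a2 := pred1 0%N)); last first.
      by move=> c /=; rewrite is_run_change0.
    by rewrite filter_pred1_uniq ?iota_uniq ?mem_iota.
  rewrite cat1s; congr (_ :: _).
  by congr map; apply: eq_filter => I; rewrite is_run_change.
subst b'; have [c [t [R t0]]] := runs_rec_head b y.
have tail : [seq I <- runs (b :: y) | I.1 != 0%N] = t.
  by rewrite IH R /=; apply/all_filterP.
have hd : [seq I <- runs (b :: y) | I.1 == 0%N] = [:: (0%N, c)].
  rewrite IH R /= (eq_in_filter (a2 := pred0)) ?filter_pred0 // => I /(allP t0).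
  by move/negPf.
rewrite [in RHS]IH R; transitivity ([:: (0%N, c.+1)] ++ map shift t) => //.
congr (_ ++ _).
  transitivity [seq (0%N, J.2.+1) | J <- [seq I <- runs (b :: y) | I.1 == 0%N]].
    rewrite runs_split filter_cat [X in _ ++ X](_ : _ = [::]); last first.
      by rewrite filter_map (eq_filter (a2 := pred0)) ?filter_pred0.
    rewrite cats0 -filter_predI.
    have -> : iota 0 (size (b :: y)).+1 =
        0%N :: map (addn 1) (iota 0 (size (b :: y))).
      by rewrite -iotaDl.
    move: (iota 0 _) => r; rewrite /= is_run_same00 -!map_comp !filter_map -!map_comp.
    by congr map; apply: eq_filter => i /=; rewrite is_run_same0.
  by rewrite hd.
rewrite -tail /runs -filter_predI; congr map; apply: eq_in_filter => I.
rewrite mem_intervals => /andP[_ ltI]; by rewrite is_run_same 1?andbC.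
Qed.

(** * The signed sum over dispersed Dyck words as a gap sum *)

Fixpoint changes (b : bool) (y : seq bool) : nat :=
  if y is b' :: y' then ((b != b') + changes b' y')%N else 0%N.

Lemma size_runs_rec b y : size (runs_rec b y) = (changes b y).+1.
Proof.
elim: y b => //= b' y IH b.
by case: eqP => _ /=; rewrite ?size_behead size_map IH.
Qed.

Lemma changes_le b y : (changes b y <= size y)%N.
Proof. by elim: y b => //= b' y IH b; have := IH b'; case: eqP => _ /=; lia. Qed.

(** The bit [c] is the parity of the number of eliminated sign changes so far. *)
Fixpoint flip_rec (c b : bool) (y : seq bool) (w : seq letter) : seq bool :=
  (b (+) c) :: if y is b' :: y' then
    if b == b' then flip_rec c b' y' w
    else flip_rec (c (+) (head None w != None)) b' y' (behead w)
  else [::].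

Lemma count_runs_recS b b' y i :
  count (fun J : nat * nat => J.2 < i.+1)%N (runs_rec b (b' :: y)) =
  ((b != b') + count (fun J : nat * nat => J.2 < i)%N (runs_rec b' y))%N.
Proof.
have [c [t [R _]]] := runs_rec_head b' y.
by rewrite /= R; case: eqP => _ /=; rewrite count_map.
Qed.

Lemma count_runs_rec0 b y :
  count (fun J : nat * nat => J.2 < 0)%N (runs_rec b y) = 0%N.
Proof. by apply/eqP; rewrite -leqn0 leqNgt -has_count; apply/hasPn. Qed.

Lemma flip_recE c b y w :
  [seq nth false (b :: y) i (+) (c (+) odd (count (predC1 None)
     (take (count (fun J : nat * nat => J.2 < i)%N (runs_rec b y)) w)))
  | i <- iota 0 (size y).+1] = flip_rec c b y w.
Proof.
elim: y c b w => [|b' y IH] c b w; first by rewrite /= take0 /= addbF.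
have -> : iota 0 (size (b' :: y)).+1 = 0%N :: map (addn 1) (iota 0 (size y).+1).
  by rewrite -iotaDl.
rewrite map_cons count_runs_rec0 take0 addbF [RHS]/=.
rewrite -[nth _ _ 0]/b; congr (_ :: _); rewrite -map_comp.
case: ifP => bb'; rewrite -IH; apply: eq_map => i; rewrite [comp _ _ _]/= add1n.
  by have /= -> := count_runs_recS b b' y i; rewrite bb'.
have /= -> := count_runs_recS b b' y i; rewrite bb' /= add1n.
case: w => [|[a|] w] /=; rewrite ?addbF //.
by rewrite -addbA addTb.
Qed.

Lemma flip_runsE n (y : n.-tuple bool) b y' w : val y = b :: y' ->
  val (flip_runs y w) = flip_rec false b y' w.
Proof.
move=> def_y; rewrite -flip_recE -runsE -def_y.
have sz : (size y').+1 = n by rewrite -[LHS]/(size (b :: y')) -def_y size_tuple.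
rewrite sz -val_enum_ord -map_comp /=; apply: eq_map => i /=.
by rewrite (tnth_nth false) def_y.
Qed.

Definition letter_weight (a : letter) (l r : bool) : int :=
  match a with Some true => sgn l | Some false => sgn r | None => 1 end.

Fixpoint weight_rec (p : color) (x : seq color) (w : seq letter) : int :=
  if x is q :: x' then
    if p.1 == q.1 then weight_rec q x' w
    else letter_weight (head None w) p.2 q.2 * weight_rec q x' (behead w)
  else 1.

Lemma weight_recE p x w :
  \prod_(j < changes p.1 (map fst x))
    letter_weight (nth None w j)
      (nth false (map snd (p :: x))
         (nth (0%N, 0%N) (runs_rec p.1 (map fst x)) j).2)
      (nth false (map snd (p :: x))
         (nth (0%N, 0%N) (runs_rec p.1 (map fst x)) j.+1).1)
  = weight_rec p x w.
Proof.
elim: x p w => [|q x IH] p w; first by rewrite big_ord0.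
have sz := size_runs_rec q.1 (map fst x).
rewrite /=; case: ifP => bb' /=.
  rewrite add0n -IH; apply: eq_bigr => j _.
  have ltj : (j.+1 < size (runs_rec q.1 (map fst x)))%N by rewrite sz ltnS.
  congr letter_weight.
    case: (val j) ltj => [|k] ltk.
      by rewrite /= -nth0 (nth_map (0%N, 0%N)) // ltnW.
    by rewrite /= nth_behead (nth_map (0%N, 0%N)) // ltnW.
  by rewrite nth_behead (nth_map (0%N, 0%N)).
rewrite add1n big_ord_recl /=; congr (_ * _).
  rewrite (nth_map (0%N, 0%N)) ?sz //=.
  have [c [t [-> _]]] := runs_rec_head q.1 (map fst x).
  by case: w.
rewrite -IH; apply: eq_bigr => j _.
have ltj : (j.+1 < size (runs_rec q.1 (map fst x)))%N by rewrite sz ltnS.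
rewrite /= add0n; congr letter_weight; first by case: w => //=; rewrite nth_nil.
  by rewrite (nth_map (0%N, 0%N)) // ltnW.
by rewrite (nth_map (0%N, 0%N)).
Qed.

Lemma sum_letter_tuple k (F : seq letter -> int) :
  \sum_(w : k.+1.-tuple letter) F w =
  \sum_(w : k.-tuple letter)
     (F (None :: w) + F (Some true :: w) + F (Some false :: w)).
Proof.
pose g (aw : letter * k.-tuple letter) := cons_tuple aw.1 aw.2.
have g_bij : bijective g.
  exists (fun w => (thead w, behead_tuple w)) => [[a w]|w].
    by congr (_, _); apply: val_inj.
  by apply: val_inj; rewrite [in RHS](tuple_eta w).
rewrite (reindex g) /=; last exact: onW_bij.
rewrite -(pair_bigA _ (fun a w => F (val (g (a, w))))) exchange_big /=.
apply: eq_bigr => w _.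
rewrite (bigD1 None) //= (bigD1 (Some true)) //= (bigD1 (Some false)) //=.
rewrite big_pred0 ?addr0 ?addrA //.
by case=> [[]|].
Qed.

Lemma sum_letter_tuple0 (F : seq letter -> int) :
  \sum_(w : 0.-tuple letter) F w = F [::].
Proof.
rewrite (eq_bigr (fun=> F [::])) => [|w _]; last by rewrite (tuple0 w).
by rewrite sumr_const cardT -cardE card_tuple expn0.
Qed.

Definition signed_term h c (p : color) x (f : seq bool -> int)
    (w : seq letter) : int :=
  if dd_path h w then
    (-1) ^+ num_plus w * weight_rec p x w * f (flip_rec c p.1 (map fst x) w)
  else 0.

(** The signed sum over letters on the sign changes only is the one over all gaps,
    because the power of 2 counts the gaps without sign change. *)
Lemma signed_sum_transfer h c p x f :
  2 ^+ (size x - changes p.1 (map fst x)) *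
    (\sum_(w : (changes p.1 (map fst x)).-tuple letter)
       signed_term h c p x f w) =
  transfer h (p.1 (+) c) p x f.
Proof.
elim: x h c p f => [|q x IH] h c p f.
  by rewrite sum_letter_tuple0 /signed_term /= /num_plus /= expr0 !mul1r; case: h.
have le_ch : (changes q.1 (map fst x) <= size x)%N.
  by rewrite -[X in (_ <= X)%N](size_map fst) changes_le.
rewrite /= /step; case: (eqVneq p.1 q.1) => pq /=.
  rewrite add0n subSn // exprS -mulrA pq -IH; congr (2 * (_ * _)).
  by apply: eq_bigr => w _ /=; rewrite /signed_term /= pq eqxx.
rewrite add1n subSS sum_letter_tuple.
have sq : (~~ (p.1 (+) c)) = q.1 (+) c by case: (p.1) (q.1) (c) pq => [] [] [].
have sq' : (p.1 (+) c) = q.1 (+) ~~ c by case: (p.1) (q.1) (c) pq => [] [] [].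
rewrite sq; set s := p.1 (+) c.
have E h' : transfer h' s q x (fun u => f (s :: u)) =
  transfer h' (q.1 (+) ~~ c) q x (fun u => f (s :: u)) by rewrite /s sq'.
have none w : signed_term h c p (q :: x) f (None :: w) =
    if h is 0 then signed_term 0 c q x (fun u => f (s :: u)) w else 0.
  rewrite /signed_term /= (negPf pq) /= mul1r addbF.
  by case: h => //= _.
have plus w : signed_term h c p (q :: x) f (Some true :: w) =
    - sgn p.2 * signed_term h.+1 (~~ c) q x (fun u => f (s :: u)) w.
  rewrite /signed_term /= (negPf pq) /= addbT; case: ifP => _; last by rewrite mulr0.
  rewrite /num_plus /= exprS; ring.
have minus w : signed_term h c p (q :: x) f (Some false :: w) =
    if h is h'.+1 then sgn q.2 * signed_term h' (~~ c) q x (fun u => f (s :: u)) w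
    else 0.
  rewrite /signed_term /= (negPf pq) /= addbT; case: h {none plus} => // h.
  case: ifP => _; last by rewrite mulr0.
  rewrite /num_plus /= add0n; ring.
under eq_bigr do rewrite none plus minus.
rewrite !big_split /= -mulr_sumr !mulrDr E.
rewrite -(IH h.+1 (~~ c)).
case: h {none plus minus} => [|h].
  rewrite -(IH 0%N c) big1_eq; ring.
rewrite E -(IH h (~~ c)) big1_eq -mulr_sumr; ring.
Qed.

Definition colors (x : seq int) : seq color :=
  [seq (color_y a, color_z a) | a <- x].

Lemma Q_transfer n (x : n.+1.-tuple int) :
  Q x = if proper_coloring x then gap_sum (colors x) pattern_count else 0.
Proof.
rewrite /Q; case: ifP => // _.
case: x => [[|a x] sz] //; have szx : size x = n by have [] := eqP sz.
set y := [tuple of map color_y _]; set z := [tuple of map color_z _].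
have Y : val y = color_y a :: map color_y x by [].
pose p : color := (color_y a, color_z a).
have Ex : map fst (colors x) = map color_y x by rewrite -map_comp.
have Ez : map snd (colors x) = map color_z x by rewrite -map_comp.
have Rn : runs y = runs_rec p.1 (map fst (colors x)).
  by rewrite -[tval y]/(val y) Y runsE Ex.
have R : (num_runs y).-1 = changes p.1 (map fst (colors x)).
  by rewrite /num_runs Rn size_runs_rec.
transitivity (transfer 0 (p.1 (+) false) p (colors x) pattern_count);
  last by rewrite addbF.
rewrite -signed_sum_transfer.
congr (2 ^+ _ * _).
  by rewrite /num_runs Rn size_runs_rec size_map szx subSS.
pose G (w : seq letter) := signed_term 0 false p (colors x) pattern_count w.
have EG (w : (num_runs y).-1.-tuple letter) :
  (if w \in DD (num_runs y).-1 then
     (-1) ^+ num_plus w * c_weight z w * (alpha (flip_runs y w))%:Z else 0) = G w.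
  rewrite inE dispersed_dyckE /G /signed_term; case: ifP => // _.
  rewrite pattern_countE -[tval (flip_runs _ _)]/(val (flip_runs y w)).
  rewrite (flip_runsE _ Y) Ex; congr (_ * _ * _).
  rewrite -weight_recE -R; apply: eq_bigr => j _.
  rewrite (tnth_nth None) /left_of_change /right_of_change Rn.
  by rewrite /= Ez.
rewrite big_mkcond (eq_bigr _ (fun w _ => EG w)).
by rewrite -[signed_term _ _ _ _ _]/G -R.
Qed.

(** * Equality of the two counts *)

Definition is_color (a : int) : bool := a \in [:: 1; 2; 3; 4].

Lemma proper_colors (x : seq int) : all is_color x ->
  proper_coloring (colors x) = proper_coloring x.
Proof.
have inj (a b : int) : is_color a -> is_color b ->
    ((color_y a, color_z a) != (color_y b, color_z b)) = (a != b).
  rewrite /is_color !inE => /or4P[] /eqP-> /or4P[] /eqP-> //.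
case: x => // a x; rewrite /proper_coloring /=; elim: x a => //= b x IH a.
by move=> /and3P[ca cb cx]; rewrite -inj // IH //= cb.
Qed.

Lemma all_delete_at (T : eqType) (P : pred T) k (l : seq T) :
  all P l -> all P (delete_at k l).
Proof.
move/allP=> Pl; apply/allP => a; rewrite mem_cat => /orP[/mem_take|/mem_drop];
  exact: Pl.
Qed.

(** Both sides satisfy the same recursion on the length of the word. *)
Lemma B_gap_sum n (x : n.-tuple int) : all is_color x ->
  (B x)%:Z = if proper_coloring x then gap_sum (colors x) pattern_count else 0.
Proof.
elim: n x => [|n IH] x cx; first by rewrite B_nil (tuple0 x) /= pattern_count_nil.
rewrite B_rec; case: ifP => // px; rewrite raddf_sum /=.
have pcx : proper_coloring (colors x) by rewrite proper_colors.
have ne : colors x != [::] by rewrite -size_eq0 size_map size_tuple.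
(* the recursion for the signed sum, like the one for [alpha], is for its double *)
apply: (@mulfI _ 2) => //.
transitivity (gap_sum (colors x) (fun u => pattern_count (behead u) +
   (pattern_count (drop_last u) + gap_deletions pattern_count u))).
  rewrite gap_sum_deletion // size_map size_tuple; congr (2 * _).
  apply: eq_bigr => k _; rewrite IH; last by rewrite tuple_deleteE all_delete_at.
  by rewrite -proper_colors tuple_deleteE ?all_delete_at // /colors map_delete_at.
case: (colors x) ne => // p cs _ /=; rewrite -transferZ.
by apply: eq_transfer => u; rewrite pattern_count_gap.
Qed.

Theorem theorem18 (n : nat) (hn : (1 <= n)%N) (x : n.-tuple int)
    (hx : forall i : 'I_n, tnth x i \in [:: 1; 2; 3; 4]) :
  (B x)%:Z = Q x.
Proof.
case: n hn x hx => // n _ x hx.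
by rewrite Q_transfer B_gap_sum //; apply/all_tnthP.
Qed.
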